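(* Let $G$ be a profinite group with a closed normal subgroup $N$ that is a virtual retract of $G$, and suppose that $G/N$ is finitely generated. Then for every open subgroup $H$ of $G$ containing $N$, there exists a closed normal finitely generated subgroup $M$ of $G$ such that \[ M\leq H,\qquad M\cap N=1,\qquad MN \text{ is open in } G. \]
   Context: A closed subgroup $N$ of a profinite group $G$ is a virtual retract of $G$ if there are an open subgroup $K$ of $G$ containing $N$ and a continuous epimorphism $\rho:K\to N$ restricting to the identity on $N$. For profinite groups, ''finitely generated'' means topologically finitely generated. *)

(* Defs.v *)
From HB Require Import structures.
From mathcomp Require Import all_boot.
From mathcomp Require Import all_classical topology.
Set Implicit Arguments.
Unset Strict Implicit.
Unset Printing Implicit Defensive.
Local Open Scope classical_set_scope.
Local Open Scope quotient_scope.
Local Open Scope group_scope.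

HB.mixin Record isTopologicalGroup G & Group G & Topological G := {
  mulg_continuous : continuous (fun x : G * G => x.1 * x.2) ;
  invg_continuous : continuous (fun x : G => x^-1)
}.

#[short(type="topologicalGroupType")]
HB.structure Definition TopologicalGroup :=
  {G of Group G & Topological G & isTopologicalGroup G}.

HB.mixin Record isProfinite G & TopologicalGroup G := {
  profinite_compact : compact [set: G] ;
  profinite_hausdorff : hausdorff_space G ;
  profinite_totally_disconnected : totally_disconnected [set: G]
}.

#[short(type="profiniteGroupType")]
HB.structure Definition ProfiniteGroup :=
  {G of TopologicalGroup G & isProfinite G}.

Section Subgroups.
Context {G : groupType}.
Implicit Types A N : set G.

Definition subgroup A :=
  [/\ A 1, forall x y, A x -> A y -> A (x * y) & forall x, A x -> A x^-1].

Definition normal_subgroup N :=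
  subgroup N /\ forall x g, N x -> N (x ^ g).

Lemma normal_subgroup1 N : normal_subgroup N -> N 1.
Proof. by case=> -[]. Qed.

Lemma normal_subgroupM N x y : normal_subgroup N -> N x -> N y -> N (x * y).
Proof. by case=> -[_ + _] _; apply. Qed.

Lemma normal_subgroupV N x : normal_subgroup N -> N x -> N x^-1.
Proof. by case=> -[_ _ +] _; apply. Qed.

Lemma normal_subgroupJ N x g : normal_subgroup N -> N x -> N (x ^ g).
Proof. by case=> _; apply. Qed.

End Subgroups.

(* The topological quotient group G / N. *)
Section QuotientGroup.
Context {G : topologicalGroupType} {N : set G}.
Variable nN : normal_subgroup N.

Definition coset_rel (x y : G) : bool := `[< N (x^-1 * y) >].

Fact coset_rel_refl : reflexive coset_rel.
Proof. by move=> x; apply/asboolP; rewrite mulVg; exact: normal_subgroup1. Qed.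

Fact coset_rel_sym : symmetric coset_rel.
Proof.
by move=> x y; apply/asboolP/asboolP => /(normal_subgroupV nN); rewrite invgM invgK.
Qed.

Fact coset_rel_trans : transitive coset_rel.
Proof.
move=> y x z /asboolP xy /asboolP yz; apply/asboolP.
by have := normal_subgroupM nN xy yz; rewrite mulgA mulgK.
Qed.

Canonical coset_equiv :=
  EquivRel coset_rel coset_rel_refl coset_rel_sym coset_rel_trans.

Definition quotg := quotient_topology {eq_quot coset_equiv}.

HB.instance Definition _ := Topological.on quotg.
HB.instance Definition _ := Quotient.on quotg.

Local Notation cl x := (\pi_quotg x%g : quotg).

Lemma quotg_eq (x y : G) : \pi_quotg x = \pi_quotg y <-> N (x^-1 * y).
Proof.
split=> [h|h].
  by apply/asboolP; apply/(@eqquotP _ _ {eq_quot coset_equiv}).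
by apply/(@eqquotP _ _ {eq_quot coset_equiv}); apply/asboolP.
Qed.

Definition quotg_one : quotg := cl 1.
Definition quotg_mul (a b : quotg) : quotg := cl (repr a * repr b).
Definition quotg_inv (a : quotg) : quotg := cl (repr a)^-1.

Lemma quotg_mulE (x y : G) : quotg_mul (cl x) (cl y) = cl (x * y).
Proof.
apply/quotg_eq.
have hx : N ((repr (cl x))^-1 * x) by apply/quotg_eq; rewrite reprK.
have hy : N ((repr (cl y))^-1 * y) by apply/quotg_eq; rewrite reprK.
move: (repr _) (repr _) hx hy => y' x' hx hy.
have := normal_subgroupM nN (normal_subgroupJ y' nN hx) hy.
by rewrite /conjg invgM !mulgA mulgK.
Qed.

Lemma quotg_invE (x : G) : quotg_inv (cl x) = cl x^-1.
Proof.
apply/quotg_eq; rewrite invgK.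
have hx : N ((repr (cl x))^-1 * x) by apply/quotg_eq; rewrite reprK.
move: (repr _) hx => x' hx.
have := normal_subgroupJ x'^-1 nN (normal_subgroupV nN hx).
by rewrite /conjg invgM !invgK !mulgA mulgK.
Qed.

Fact quotg_mulA : associative quotg_mul.
Proof.
move=> a b c; rewrite -[a]reprK -[b]reprK -[c]reprK.
move: (repr a) (repr b) (repr c) => x y z.
by rewrite (quotg_mulE y z) (quotg_mulE x y) !quotg_mulE mulgA.
Qed.

Fact quotg_mul1g : left_id quotg_one quotg_mul.
Proof. by move=> a; rewrite -[a]reprK quotg_mulE mul1g. Qed.

Fact quotg_mulg1 : right_id quotg_one quotg_mul.
Proof. by move=> a; rewrite -[a]reprK quotg_mulE mulg1. Qed.

Fact quotg_mulVg : left_inverse quotg_one quotg_inv quotg_mul.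
Proof. by move=> a; rewrite -[a]reprK quotg_invE quotg_mulE mulVg. Qed.

Fact quotg_mulgV : right_inverse quotg_one quotg_inv quotg_mul.
Proof. by move=> a; rewrite -[a]reprK quotg_invE quotg_mulE mulgV. Qed.

HB.instance Definition _ := isGroup.Build quotg
  quotg_mulA quotg_mul1g quotg_mulg1 quotg_mulVg quotg_mulgV.

Lemma quotg_piM (x y : G) :
  \pi_quotg (x * y) = \pi_quotg x * \pi_quotg y :> quotg.
Proof. exact/esym/quotg_mulE. Qed.

Lemma quotg_piV (x : G) : \pi_quotg x^-1 = (\pi_quotg x)^-1 :> quotg.
Proof. exact/esym/quotg_invE. Qed.

Lemma quotg_pi_continuous : continuous (\pi_quotg : G -> quotg).
Proof. exact: pi_continuous. Qed.

Lemma quotg_pi_open (U : set G) : open U -> open (\pi_quotg @` U : set quotg).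
Proof.
move=> oU; rewrite /open /= /quotient_open.
rewrite (_ : _ @^-1` _ = \bigcup_(n in N) ((fun x => x * n) @^-1` U)).
  apply: bigcup_open => n Nn; apply: open_comp => // x _.
  apply: (@continuous_comp _ _ _ (fun x : G => (x, n))
            (fun z : G * G => z.1 * z.2)); last exact: mulg_continuous.
  by apply: cvg_pair => /=; [exact: cvg_id | exact: cvg_cst].
apply/seteqP; split=> [x [u Uu /esym/quotg_eq xu]|x [n Nn Uxn]] /=.
  by exists (x^-1 * u) => //=; rewrite mulgA mulgV mul1g.
by exists (x * n) => //; apply/esym/quotg_eq; rewrite mulgA mulVg mul1g.
Qed.

Fact quotg_mul_continuous : continuous (fun a : quotg * quotg => a.1 * a.2).
Proof.
move=> [a b]; rewrite -[a]reprK -[b]reprK.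
move: (repr a) (repr b) => x y W /=.
rewrite -quotg_piM => /(@quotg_pi_continuous (x * y)) nW.
have [[U V] [/= nU nV] UV] := @mulg_continuous G (x, y) _ nW.
exists (\pi_quotg @` U, \pi_quotg @` V) => /=.
  split.
    move: nU; rewrite !nbhsE => -[U' [oU' U'x] U'U].
    exists (\pi_quotg @` U'); last exact: image_subset.
    by split; [exact: quotg_pi_open | exists x].
  move: nV; rewrite !nbhsE => -[V' [oV' V'x] V'V].
  exists (\pi_quotg @` V'); last exact: image_subset.
  by split; [exact: quotg_pi_open | exists y].
move=> [_ _] /= [[u Uu <-] [v Vv <-]]; rewrite -quotg_piM.
exact: (UV (u, v)).
Qed.

Fact quotg_inv_continuous : continuous (fun a : quotg => a^-1).
Proof.
apply/quotient_continuous.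
rewrite (_ : _ \o _ = (\pi_quotg : G -> quotg) \o (fun x : G => x^-1)).
  move=> x; apply: continuous_comp; first exact: invg_continuous.
  exact: quotg_pi_continuous.
by apply/funext => x /=; rewrite quotg_piV.
Qed.

HB.instance Definition _ := isTopologicalGroup.Build quotg
  quotg_mul_continuous quotg_inv_continuous.

End QuotientGroup.

Section TopologicalGroups.
Context {G : topologicalGroupType}.
Implicit Types A K N S : set G.

(* For a closed subgroup A, closures in A and in G of subsets of A agree, so
   this is topological finite generation of A as a group in its own right. *)
Definition topologically_fg A :=
  exists2 S : set G, finite_set S & closure (smallest subgroup S) = A.

(* A continuous epimorphism K ->> N; rho is irrelevant outside K. *)
Definition continuous_epimorphism K N (rho : G -> G) :=
  [/\ {within K, continuous rho},
      forall x y, K x -> K y -> rho (x * y) = rho x * rho y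
    & rho @` K = N].

Definition virtual_retract N :=
  exists K (rho : G -> G),
    [/\ subgroup K, open K, N `<=` K, continuous_epimorphism K N rho
      & forall x, N x -> rho x = x].

End TopologicalGroups.

Definition topologically_fg_group (G : topologicalGroupType) :=
  topologically_fg [set: G].

(* Main.v *)
(* After shrinking the open subgroup carrying the retraction, there is an open
   normal subgroup K of G with N <= K <= H and a retraction rho of K onto N. Its
   kernel L centralizes N, K = L N, and L is finitely generated because it embeds
   as an open subgroup of G/N. The only defect of L is that it need not be normal
   in G. Let D0 be the closed normal subgroup of G generated by L; it lies in the
   centralizer of N, and Z0 = D0 cap N = rho(D0) is an abelian group generated by
   the images under rho of finitely many conjugates of the generators of L.
   Averaging rho over the n cosets of K gives a G-equivariant homomorphism sigma
   from D0 to Z0 that raises elements of Z0 to the power n. Its kernel M0 is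
   normal in G, M0 Z0 has finite index in D0 since Z0/Z0^n is finite, and
   M0 cap N is the n-torsion of Z0. As Z0 is finitely generated it has a closed
   subgroup Y of finite index without n-torsion, and M is the largest normal
   subgroup of G inside M0 cap rho^-1(Y). *)
Require Import Defs.
From mathcomp Require Import all_boot.
From mathcomp Require Import all_classical topology.
Set Implicit Arguments.
Unset Strict Implicit.
Unset Printing Implicit Defensive.
Local Open Scope classical_set_scope.
Local Open Scope quotient_scope.
Local Open Scope group_scope.

(** * Clopen separation in compact Hausdorff spaces *)

Lemma compact_seq_cover (T : topologicalType) (A : set T) (V : T -> set T) :
  compact A -> (forall x, A x -> nbhs x (V x)) ->
  exists s : seq T, forall x, A x -> exists2 y, y \in s & A y /\ V y x.
Proof.
move=> /compact_near_coveringP cA nV.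
(* Finite lists ordered by inclusion give a filter, so the near-covering form of compactness yields
   one list that serves every point. *)
pose F := filter_from [set: seq T]
  (fun s => [set t : seq T | forall y, y \in s -> y \in t]).
have FF : Filter F.
  apply: filter_from_filter; first by exists [::].
  move=> s t _ _; exists (s ++ t) => // u stu; split=> y ys; apply: stu;
    by rewrite mem_cat ys ?orbT.
have [|s _ sP] := cA _ F (fun s x => exists2 y, y \in s & A y /\ V y x) FF.
  move=> x Ax; exists (V x, [set t | x \in t]) => /=.
    split; first exact: nV.
    by exists [:: x] => // t /=; apply; rewrite mem_head.
  by move=> [y t] /= [Vy xt]; exists x.
by exists s => x; apply: sP.
Qed.

(* A clopen partition of the quasicomponent extends, by normality, to disjoint
   open sets, and by compactness to a clopen partition of a clopen set. *)
Lemma quasicomponent_connected (T : topologicalType) (x : T) :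
  hausdorff_space T -> compact [set: T] ->
  connected [set y : T | forall C : set T, clopen C -> C x -> C y].
Proof.
move=> hT cT; set Q := (X in connected X).
have clopen_nbhd W : open W -> Q `<=` W ->
    exists C, [/\ clopen C, C x & C `<=` W].
  move=> oW QW.
  have /choice[c cP] : forall y, exists C,
      ~ W y -> [/\ clopen C, C x & ~ C y].
    move=> y; have [Wy|nWy] := pselect (W y); first by exists setT.
    have /existsNP[C /not_implyP[cC /not_implyP[Cx Cy]]] : ~ Q y.
      by move=> /QW.
    by exists C.
  have cW : compact (~` W).
    by apply: subclosed_compact cT _ => //; exact: open_closedC.
  have [y nWy|s sP] := compact_seq_cover (V := fun y => ~` c y) cW.
    have [[_ cl] _ ncy] := cP _ nWy.
    by apply: open_nbhs_nbhs; split => //; exact: closed_openC.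
  have [C [cC Cx Cs]] : exists C, [/\ clopen C, C x &
      forall y, y \in s -> ~ W y -> C `<=` c y].
    elim: s {sP} => [|y s [C [cC Cx Cs]]].
      by exists setT; split => //; exact: clopenT.
    have [Wy|nWy] := pselect (W y).
      exists C; split=> // z; rewrite inE => /orP[/eqP -> //|]; exact: Cs.
    have [cy cx _] := cP _ nWy.
    exists (C `&` c y); split=> //; first exact: clopenI.
    move=> z; rewrite inE => /orP[/eqP -> _ t []//|zs nWz t [+ _]].
    exact: Cs.
  exists C; split=> // t Ct; apply: contrapT => nWt.
  by have [y ys [nWy]] := sP t nWt; apply; exact: Cs Ct.
move=> B [b Bb] [O oO BQO] [E cE BQE].
have QE : Q `\` B = Q `&` ~` O.
  rewrite BQO; apply/seteqP.
  split=> y [Qy nO]; split=> // Oy; apply: nO; first by split.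
  by case: Oy.
have cQ : closed Q.
  rewrite (_ : Q = \bigcap_(C in [set C | clopen C /\ C x]) C).
    by apply: closed_bigI => C [[]].
  by apply/seteqP; split=> y Qy C; [case=> cC Cx; exact: Qy|move=> ? ?; exact: Qy].
have cB : closed B by rewrite BQE; exact: closedI.
have cQB : closed (Q `\` B).
  by rewrite QE; apply: closedI => //; exact: open_closedC.
have [|W /set_nbhsP[U [oU BU UW]] WQB] :=
    compact_normal hT cT cB (_ : set_nbhs B (~` (Q `\` B))).
  apply/set_nbhsP; exists (~` (Q `\` B)); split=> [|y By [_ /(_ By)//]|//].
  exact: closed_openC.
pose V := ~` closure W.
have oV : open V by apply: closed_openC; exact: closed_closure.
have UV y : U y -> V y -> False by move=> /UW /subset_closure.
have QUV : Q `<=` U `|` V.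
  move=> y Qy; have [/BU|nBy] := pselect (B y); first by left.
  by right=> /WQB; apply.
have [C [[oC cC] Cx CUV]] := clopen_nbhd _ (openU oU oV) QUV.
have half U1 V1 : open U1 -> open V1 -> (forall y, U1 y -> V1 y -> False) ->
    C `<=` U1 `|` V1 -> U1 x -> Q `<=` U1.
  move=> oU1 oV1 UV1 CUV1 U1x y Qy.
  have [] : (C `&` U1) y; last by [].
  apply: Qy => //; split; first exact: openI.
  rewrite (_ : C `&` U1 = C `&` ~` V1).
    by apply: closedI => //; exact: open_closedC.
  apply/seteqP; split=> z [Cz]; first by move=> Uz; split=> // /(UV1 _ Uz).
  by move=> nVz; split=> //; have [] := CUV1 z Cz.
have Qx : Q x by [].
have [Ux|Vx] := CUV x Cx.
  have QU := half _ _ oU oV UV CUV Ux.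
  apply/seteqP; split=> [y|y Qy]; first by rewrite BQO => -[].
  apply: contrapT => nBy; apply: (UV y); first exact: QU.
  by move=> /WQB; apply.
have := half V U oV oU (fun y Vy Uy => UV y Uy Vy).
rewrite setUC => /(_ CUV Vx) QV.
have := QV b; rewrite BQO in Bb; case: (Bb) => Qb _ /(_ Qb).
by move/(UV b _); case; apply: BU; rewrite BQO.
Qed.

(** A point lying in every clopen neighbourhood of [x] belongs to a connected set containing [x],
    which total disconnectedness reduces to [x]. *)
Lemma compact_totally_disconnected_zero_dimensional (T : topologicalType) :
  hausdorff_space T -> compact [set: T] -> totally_disconnected [set: T] ->
  zero_dimensional T.
Proof.
move=> hT cT tdT x y xy.
have /existsNP[C /not_implyP[cC /not_implyP[Cx nCy]]] :
    ~ (forall C : set T, clopen C -> C x -> C y).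
  move=> Qy; have : connected_component [set: T] x y.
    exact: connected_component_max (quasicomponent_connected hT cT) _ Qy.
  by rewrite tdT // => yx; rewrite yx eqxx in xy.
by exists C.
Qed.

(** * Subgroups, finite index and normal cores *)

Section Subgroups.
Context {G : groupType}.
Implicit Types A B : set G.

Lemma subgroup1 A : subgroup A -> A 1. Proof. by case. Qed.

Lemma subgroupM A x y : subgroup A -> A x -> A y -> A (x * y).
Proof. by case=> _ + _; apply. Qed.

Lemma subgroupV A x : subgroup A -> A x -> A x^-1.
Proof. by case=> _ _; apply. Qed.

Lemma subgroupF A x y : subgroup A -> A x -> A y -> A (x^-1 * y).
Proof. by move=> sA Ax Ay; apply: subgroupM => //; exact: subgroupV. Qed.

Lemma subgroupX A x n : subgroup A -> A x -> A (x ^+ n).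
Proof.
move=> sA Ax; elim: n => [|n IHn]; first exact: subgroup1.
by rewrite expgS; exact: subgroupM.
Qed.

Lemma subgroupJ A x y : subgroup A -> A x -> A y -> A (x ^ y).
Proof.
by move=> sA Ax Ay; rewrite /conjg; apply: subgroupF => //; exact: subgroupM.
Qed.

Lemma subgroupMl A x y : subgroup A -> A x -> A (x * y) -> A y.
Proof. by move=> sA Ax Axy; rewrite -(mulKg x y); exact: subgroupF. Qed.

Lemma subgroupMr A x y : subgroup A -> A y -> A (x * y) -> A x.
Proof.
by move=> sA Ay Axy; rewrite -(mulgK y x); apply: subgroupM => //; exact: subgroupV.
Qed.

Lemma subgroupI A B : subgroup A -> subgroup B -> subgroup (A `&` B).
Proof.
move=> sA sB; split=> [|x y [Ax Bx] [Ay By]|x [Ax Bx]].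
- by split; exact: subgroup1.
- by split; exact: subgroupM.
- by split; exact: subgroupV.
Qed.

Lemma subgroup_smallest (X : set G) : subgroup (smallest subgroup X).
Proof.
split=> [A [sA _]|x y hx hy A XA|x hx A XA]; first exact: subgroup1.
- by apply: subgroupM; [exact: XA.1|exact: hx|exact: hy].
- by apply: subgroupV; [exact: XA.1|exact: hx].
Qed.

(** Finite index is a finite cover by left translates, so no coset space is needed; neither [B] nor
    the representatives have to lie in [A]. *)
Definition fin_index A B :=
  exists s : seq G, forall x, A x -> exists2 y, y \in s & B (y^-1 * x).

Lemma fin_index_trans A B C : fin_index A B -> fin_index B C -> fin_index A C.
Proof.
move=> [s sP] [t tP]; exists [seq y * z | y <- s, z <- t] => x /sP[y ys /tP[z zt Cz]].
by exists (y * z); [exact: allpairs_f|rewrite invgM -mulgA].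
Qed.

Lemma fin_indexS A A' B B' :
  A' `<=` A -> B `<=` B' -> fin_index A B -> fin_index A' B'.
Proof. by move=> sA sB [s sP]; exists s => x /sA/sP[y ys /sB]; exists y. Qed.

(* Some translates in the hypothesis may miss the image of [A]; the new
   representatives are preimages of points in the translates that do not. *)
Lemma fin_index_preimage A C D (f : G -> G) :
  (forall x y, A x -> A y -> f (x^-1 * y) = (f x)^-1 * f y) ->
  subgroup A -> subgroup D -> f @` A `<=` C -> fin_index C D ->
  fin_index A (A `&` f @^-1` D).
Proof.
move=> fM sA sD fAC [s sP].
have /choice[g gP] : forall y, exists a, (exists2 b, A b & D (y^-1 * f b)) ->
    A a /\ D (y^-1 * f a).
  move=> y; have [[b Ab Db]|ny] := pselect (exists2 b, A b & D (y^-1 * f b)).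
    by exists b.
  by exists 1 => /ny.
exists (map g s) => x Ax; have [|y ys Dy] := sP (f x); first by apply: fAC; exists x.
have [|Ag Dg] := gP y; first by exists x.
exists (g y); first exact: map_f.
split; first exact: subgroupF.
rewrite /= fM // -(mulVKg y (f x)) mulgA -[_^-1 * y]invgK invgM invgK.
exact: subgroupF.
Qed.

(** The normal core, that is, the intersection of all conjugates of [A]. *)
Definition core A : set G := [set x | forall g, A (x ^ g)].

Lemma core_sub A : core A `<=` A.
Proof. by move=> x /(_ 1); rewrite conjg1. Qed.

Lemma core_normal A : subgroup A -> normal_subgroup (core A).
Proof.
move=> sA; split; last by move=> x g cx h; rewrite -conjgM.
split=> [g|x y cx cy g|x cx g].
- by rewrite conj1g; exact: subgroup1.
- by rewrite conjMg; exact: subgroupM.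
- by rewrite conjVg; exact: subgroupV.
Qed.

(** Since [K] stabilizes [B] and has finite index, [B] has finitely many conjugates, at most one for
    each representative in [s]. Each has finite index in the normal subgroup [A], and the core is
    their intersection. *)
Lemma fin_index_core A B K : normal_subgroup A -> subgroup B -> B `<=` A ->
  (forall x k, K k -> B x -> B (x ^ k)) -> fin_index setT K ->
  fin_index A B -> fin_index A (core B).
Proof.
move=> nA sB BA KB [s sP] AB.
have [sA JA] := nA.
have [t tP] : exists t : seq G, forall x, A x ->
    exists2 y, y \in t & A (y^-1 * x) /\ forall r, r \in s -> B ((y^-1 * x) ^ r).
  elim: s {sP} => [|r s [t tP]].
    exists [:: 1] => x Ax; exists 1; first exact: mem_head.
    by rewrite invg1 mul1g.
  pose C := [set x | A x /\ forall q, q \in s -> B (x ^ q)].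
  have sC : subgroup C.
    split=> [|x y [Ax Cx] [Ay Cy]|x [Ax Cx]].
    - split=> [|q _]; rewrite ?conj1g; exact: subgroup1.
    - by split=> [|q qs]; rewrite ?conjMg; apply: subgroupM => //; auto.
    - by split=> [|q qs]; rewrite ?conjVg; apply: subgroupV => //; auto.
  have AC : fin_index A C by exists t.
  have CB : fin_index C (C `&` (fun x => x ^ r) @^-1` B).
    apply: (@fin_index_preimage C A B) => //.
    - by move=> x y _ _; rewrite conjMg conjVg.
    - by move=> _ [x [Ax _] <-]; exact: JA.
  have [u uP] := fin_index_trans AC CB; exists u => x /uP[y yu [[Ay Cy] By]].
  exists y => //; split=> // q; rewrite inE => /orP[/eqP -> //|]; exact: Cy.
exists t => x /tP[y yt [_ By]]; exists y => // g.
have [r rs Kr] := sP g I.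
by have := KB _ _ Kr (By r rs); rewrite -conjgM mulVKg.
Qed.

End Subgroups.

(** * Topological groups: closures, open and closed subgroups *)

Section TopologicalGroups.
Context {G : topologicalGroupType}.
Implicit Types A B : set G.

Lemma continuousM (T : topologicalType) (f g : T -> G) :
  continuous f -> continuous g -> continuous (fun x => f x * g x).
Proof.
move=> cf cg x; apply: (@continuous_comp _ _ _ (fun x => (f x, g x))
  (fun z : G * G => z.1 * z.2)); last exact: mulg_continuous.
by apply: cvg_pair => /=; [exact: cf|exact: cg].
Qed.

Lemma continuousJ (T : topologicalType) (f : T -> G) g :
  continuous f -> continuous (fun x => f x ^ g).
Proof.
move=> cf; apply: continuousM; first exact: cst_continuous.
by apply: continuousM => //; exact: cst_continuous.
Qed.

Lemma continuousX (T : topologicalType) (f : T -> G) n :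
  continuous f -> continuous (fun x => f x ^+ n).
Proof.
move=> cf; elim: n => [|n IHn]; first exact: cst_continuous.
rewrite (_ : (fun _ => _) = (fun x => f x * f x ^+ n)); first exact: continuousM.
by apply/funext => x; rewrite expgS.
Qed.

Lemma continuous_lmul (g : G) : continuous ( *%g g).
Proof.
by apply: (continuousM (f := fun=> g)) => [|x]; [exact: cst_continuous|exact: cvg_id].
Qed.

Lemma closed_preimage (T U : topologicalType) (f : T -> U) (A : set U) :
  continuous f -> closed A -> closed (f @^-1` A).
Proof. by move=> /continuous_closedP; apply. Qed.

Lemma open_preimage (T U : topologicalType) (f : T -> U) (A : set U) :
  continuous f -> open A -> open (f @^-1` A).
Proof. by move=> /continuousP; apply. Qed.

Lemma subgroup_closure A : subgroup A -> subgroup (closure A).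
Proof.
move=> sA.
(* Products are handled one factor at a time: first with the left factor in [A], then with the right
   factor a fixed point of the closure. *)
have cM a : A a -> closure A `<=` [set x | closure A (a * x)].
  move=> Aa; rewrite {1}closureE; apply: smallest_sub.
    exact: closed_preimage (@continuous_lmul a) (@closed_closure _ A).
  by move=> x Ax; apply: subset_closure; exact: subgroupM.
have clM x y : closure A x -> closure A y -> closure A (x * y).
  move=> Ax Ay; move: x Ax; change (closure A `<=` (fun x => x * y) @^-1` closure A).
  rewrite {1}closureE; apply: smallest_sub.
    apply: closed_preimage; last exact: closed_closure.
    by apply: (continuousM (g := fun=> y)) => [z|]; [exact: cvg_id|exact: cst_continuous].
  by move=> a Aa; exact: cM.
split=> //; first by apply: subset_closure; exact: subgroup1.
change (closure A `<=` (fun x => x^-1) @^-1` closure A).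
rewrite {1}closureE; apply: smallest_sub.
  by apply: closed_preimage; [exact: invg_continuous|exact: closed_closure].
by move=> a Aa; apply: subset_closure; exact: subgroupV.
Qed.

(** The complement is a finite union of closed left cosets. *)
Lemma closed_fin_index_open A : closed A -> subgroup A -> fin_index setT A -> open A.
Proof.
move=> cA sA [s sP].
rewrite (_ : A = ~` \bigcup_(y in [set y | y \in s /\ ~ A y]) ( *%g y^-1 @^-1` A)).
  apply: closed_openC; apply: closed_bigcup => [|y _].
    by apply: sub_finite_set (finite_seq s) => y [].
  by apply: closed_preimage cA; exact: continuous_lmul.
apply/seteqP; split=> [x Ax [y [_ nAy] /= Ayx]|x /= nx].
  by apply: nAy; rewrite -[y]invgK; apply: subgroupV => //; exact: subgroupMr Ayx.
have [y ys Ayx] := sP x I; have [Ay|nAy] := pselect (A y).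
  by rewrite -(mulVKg y x); exact: subgroupM.
by case: nx; exists y.
Qed.

Lemma open_subgroup_closed A : subgroup A -> open A -> closed A.
Proof.
move=> sA oA; rewrite -openC.
rewrite (_ : ~` A = \bigcup_(y in ~` A) ( *%g y^-1 @^-1` A)).
  apply: bigcup_open => y _; apply: open_preimage oA; exact: continuous_lmul.
apply/seteqP; split=> [x nAx|x [y nAy /= Ayx] Ax].
  by exists x => //=; rewrite mulVg; exact: subgroup1.
by apply: nAy; rewrite -[y]invgK; apply: subgroupV => //; exact: subgroupMr Ayx.
Qed.

Lemma subgroup_nbhs1_open A : subgroup A -> nbhs 1 A -> open A.
Proof.
move=> sA nA; rewrite openE => x Ax.
have /= nxA : nbhs x ( *%g x^-1 @^-1` A) by apply: continuous_lmul; rewrite mulVg.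
apply: filterS nxA => y /= Axy; rewrite -(mulVKg x y); exact: subgroupM.
Qed.

Lemma closed_core A : closed A -> closed (core A).
Proof.
move=> cA; rewrite (_ : core A = \bigcap_(g in setT) ((fun x => x ^ g) @^-1` A)).
  apply: closed_bigI => g _; apply: closed_preimage cA.
  by apply: continuousJ => x; exact: cvg_id.
by apply/seteqP; split=> x Ax g; [move=> _|]; apply: Ax.
Qed.

End TopologicalGroups.

(** * Profinite groups: compactness and open subgroups *)

Section ProfiniteGroups.
Context {G : profiniteGroupType}.
Implicit Types A B : set G.

Lemma closed_compact A : closed A -> compact A.
Proof.
by move=> cA; exact: subclosed_compact cA (@profinite_compact G) (@subsetT _ _).
Qed.

Lemma closed_fiber (T : topologicalType) (f : T -> G) (c : G) :
  continuous f -> closed [set x | f x = c].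
Proof.
move=> cf; apply: (@closed_preimage _ _ f [set c] cf).
exact: accessible_closed_set1 (hausdorff_accessible profinite_hausdorff) c.
Qed.

Lemma compact_closed_image (T : topologicalType) (f : T -> G) (A : set T) :
  continuous f -> compact A -> closed (f @` A).
Proof.
move=> cf cA; apply: compact_closed; first exact: profinite_hausdorff.
by apply: continuous_compact cA; exact: continuous_subspaceT.
Qed.

Lemma closed_mulset A B : closed A -> closed B ->
  closed [set x * y | x in A & y in B].
Proof.
move=> cA cB.
rewrite (_ : [set x * y | x in A & y in B] = (fun z => z.1 * z.2) @` (A `*` B)).
  apply: compact_closed_image; first exact: mulg_continuous.
  by apply: compact_setX; exact: closed_compact.
apply/seteqP; split=> [_ [x Ax [y By <-]]|_ [[x y] [/= Ax By] <-]].
  by exists (x, y).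
by exists x => //; exists y.
Qed.

Lemma open_fin_index A : subgroup A -> open A -> fin_index setT A.
Proof.
move=> sA oA.
have [x _|s sP] := compact_seq_cover
    (V := fun x => *%g x^-1 @^-1` A) (@profinite_compact G).
  apply: open_nbhs_nbhs; split; first by apply: open_preimage oA; exact: continuous_lmul.
  by rewrite /= mulVg; exact: subgroup1.
by exists s => x /sP[y ys [_ Ay]]; exists y.
Qed.

(** A clopen [C] separates [1] from [x]. The elements whose right translation preserves [C] form a
    subgroup, open by compactness of [C] and of its complement, which omits [x] because [1 * x]
    falls outside [C]. *)
Lemma open_subgroup_separation (x : G) : x != 1 ->
  exists A, [/\ subgroup A, open A & ~ A x].
Proof.
rewrite eq_sym => /(compact_totally_disconnected_zero_dimensional
  profinite_hausdorff profinite_compact profinite_totally_disconnected).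
move=> [C [[oC cC] C1 nCx]].
have stab D : open D -> closed D -> nbhs (1 : G) [set u | forall c, D c -> D (c * u)].
  move=> oD cD.
  have /compact_near_coveringP := closed_compact cD.
  move=> /(_ G (nbhs (1 : G)) (fun u c => D (c * u))).
  apply=> c Dc.
  have := @mulg_continuous G (c, 1); apply; rewrite /= mulg1.
  exact: open_nbhs_nbhs.
have sS : subgroup [set u | forall c, C c <-> C (c * u)].
  split=> [c|u v Cu Cv c|u Cu c].
  + by rewrite mulg1.
  + by rewrite (Cu c) (Cv (c * u)) mulgA.
  + by rewrite (Cu (c * u^-1)) mulgVK.
exists [set u | forall c, C c <-> C (c * u)]; split=> //.
  apply: subgroup_nbhs1_open => //.
  apply: filterS2 (stab _ oC cC) (stab _ (closed_openC cC) (open_closedC oC)).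
  move=> u Cu nCu c; split; first exact: Cu.
  by apply: contraPP => /nCu.
by move=> /(_ 1); rewrite mul1g => -[/(_ C1)].
Qed.

End ProfiniteGroups.

(** * Topological generators and the quotient by [N] *)

Section Generation.
Context {G : topologicalGroupType}.
Implicit Types A B N Q : set G.

Definition topologically_generated (s : seq G) A :=
  (forall x, x \in s -> A x) /\
  forall B, subgroup B -> closed B -> (forall x, x \in s -> B x) -> A `<=` B.

Lemma topologically_generated_fg s A :
  subgroup A -> closed A -> topologically_generated s A -> topologically_fg A.
Proof.
move=> sA cA [sA' gA]; exists [set` s]; first exact: finite_seq.
apply/seteqP; split.
  rewrite closureE; apply: smallest_sub => //.
  exact: smallest_sub.
apply: gA; first exact: subgroup_closure (subgroup_smallest _).
  exact: closed_closure.
by move=> x xs; apply: subset_closure => B [_]; apply.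
Qed.

(** The image of [Q] is closed in the quotient because its preimage is [Q] itself, and it contains
    the generators. The conclusion speaks only of subgroups of [G], so that later arguments take
    place inside [G]. *)
Lemma quotg_topologically_generated N (nN : normal_subgroup N) :
  topologically_fg_group (quotg nN) ->
  exists s : seq G, forall Q, subgroup Q -> closed Q -> N `<=` Q ->
    (forall x, x \in s -> Q x) -> Q = setT.
Proof.
move=> [S /finite_seqP[s ->] gS]; exists (map repr s) => Q sQ cQ NQ Qs.
pose pi := \pi_(quotg nN) : G -> quotg nN.
have piQ x : (pi @` Q) (pi x) -> Q x.
  move=> [q Qq /quotg_eq /NQ Qqx]; rewrite -(mulVKg q x); exact: subgroupM.
apply/seteqP; split=> // x _; apply: (piQ).
have : closure (smallest subgroup [set` s]) (pi x) by rewrite gS.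
rewrite closureE; apply; split.
  rewrite -openC; change (open (pi @^-1` (~` (pi @` Q)))).
  rewrite (_ : _ @^-1` _ = ~` Q); first exact: closed_openC.
  apply/seteqP; split=> y nQy; first by move=> Qy; apply: nQy; exists y.
  by move=> /piQ.
apply: smallest_sub.
  split=> [|_ _ [y Qy <-] [z Qz <-]|_ [y Qy <-]].
  - by exists 1 => //; exact: subgroup1.
  - by exists (y * z); [exact: subgroupM|exact: quotg_piM].
  - by exists y^-1; [exact: subgroupV|exact: quotg_piV].
move=> a /= sa; exists (repr a); first by apply: Qs; exact: map_f.
exact: reprK.
Qed.

End Generation.

Lemma mulset_subgroup (G : groupType) (A N : set G) :
  subgroup A -> normal_subgroup N -> subgroup [set x * y | x in A & y in N].
Proof.
move=> sA [sN JN]; split.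
- by exists 1; [exact: subgroup1|exists 1; [exact: subgroup1|rewrite mulg1]].
- move=> _ _ [x Ax [m Nm <-]] [y Ay [n Nn <-]].
  exists (x * y); first exact: subgroupM.
  exists (m ^ y * n); first by apply: subgroupM => //; exact: JN.
  by rewrite /conjg !mulgA mulgK.
- move=> _ [x Ax [m Nm <-]]; exists x^-1; first exact: subgroupV.
  exists (m^-1 ^ x^-1); first by apply: JN; exact: subgroupV.
  by rewrite /conjg invgK invgM !mulgA mulVg mul1g.
Qed.

(** * Generators of a complement of [N] in an open subgroup *)

Section Schreier.
Context {G : profiniteGroupType}.
Implicit Types A B N Q : set G.

(* Schreier's lemma in the open subgroup [A * N]: the elements
   [r^-1 * x * r'] lying in it, for [r] and [r'] representatives of its left
   cosets and [x] a generator or [1], generate it, and each of them is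
   congruent modulo [N] to an element of [A]. *)
Lemma complement_topologically_generated N A (s : seq G) :
  normal_subgroup N -> closed N ->
  (forall Q, subgroup Q -> closed Q -> N `<=` Q ->
    (forall x, x \in s -> Q x) -> Q = setT) ->
  subgroup A -> closed A -> A `&` N = [set 1] ->
  open [set x * y | x in A & y in N] ->
  exists t, topologically_generated t A.
Proof.
move=> nN cN gen sA cA AN1; set K := (X in open X) => oK.
have [sN JN] := nN.
have sK : subgroup K by exact: mulset_subgroup.
have NK : N `<=` K by move=> n Nn; exists 1; [exact: subgroup1|exists n; rewrite ?mul1g].
have [R0 R0P] := open_fin_index sK oK.
(* The representative [1] is added so that an element of [A] can be tested as [1^-1 * a * 1]. *)
pose R := 1 :: R0.
have RP x : exists2 r, r \in R & K (r^-1 * x).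
  by have [r rR Kr] := R0P x I; exists r; rewrite // inE rR orbT.
have /choice[g gP] : forall e, exists a, A a /\ (K e -> N (a^-1 * e)).
  move=> e; have [[a Aa [n Nn ne]]|nKe] := pselect (K e).
    by exists a; split=> // _; rewrite -ne mulKg.
  by exists 1; split=> //; exact: subgroup1.
exists [seq g e | e <- [seq r.1^-1 * x * r.2 |
  r <- [seq (r, r') | r <- R, r' <- R], x <- 1 :: s]].
split=> [_ /mapP[e _ ->]|B0 sB0 cB0 B0t]; first by have [] := gP e.
pose B := [set x * y | x in A `&` B0 & y in N].
have sAB : subgroup (A `&` B0) by exact: subgroupI.
have sB : subgroup B by exact: mulset_subgroup.
have NB : N `<=` B by move=> n Nn; exists 1; [exact: subgroup1|exists n; rewrite ?mul1g].
have cB : closed B by apply: closed_mulset => //; exact: closedI.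
have Bgen r r' x : r \in R -> r' \in R -> x \in 1 :: s ->
    K (r^-1 * x * r') -> B (r^-1 * x * r').
  move=> rR r'R xs Ke; set e := _ * r' in Ke *.
  have [Ag Ng] := gP e; exists (g e); last first.
    by exists ((g e)^-1 * e); [exact: Ng|rewrite mulVKg].
  split=> //; apply: B0t; apply: map_f; apply/allpairsP.
  by exists ((r, r'), x); split=> //; exact: allpairs_f.
(* Stability of [Q] under products comes from inserting a representative [q] of the coset of
   [y * r'] between the factors; [Q] is topologically closed because [K] is clopen and [B]
   closed. *)
pose Q := [set x | forall r r', r \in R -> r' \in R ->
  K (r^-1 * x * r') -> B (r^-1 * x * r')].
have QT : Q = setT.
  apply: gen.
  - split=> [r r' rR r'R|x y Qx Qy r r' rR r'R Kxy|x Qx r r' rR r'R Kx].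
    + by apply: Bgen => //; exact: mem_head.
    + have [q qR Kq] := RP (y * r').
      have Ky : K (q^-1 * y * r') by rewrite -mulgA.
      have E : r^-1 * (x * y) * r' = (r^-1 * x * q) * (q^-1 * y * r').
        by rewrite !mulgA mulgK.
      rewrite E in Kxy *; apply: subgroupM => //; last exact: Qy.
      by apply: Qx => //; exact: subgroupMr Kxy.
    + have E : r^-1 * x^-1 * r' = (r'^-1 * x * r)^-1 by rewrite !invgM invgK mulgA.
      rewrite E in Kx *; apply: subgroupV => //; apply: Qx => //.
      by rewrite -[_ * r]invgK; exact: subgroupV.
  - rewrite (_ : Q = \bigcap_(p in [set p | p.1 \in R /\ p.2 \in R])
        ((fun x => p.1^-1 * x * p.2) @^-1` (~` K `|` B))).
      apply: closed_bigI => -[r r'] _; apply: closed_preimage.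
        apply: continuousM; last exact: cst_continuous.
        exact: continuous_lmul.
      by apply: closedU => //; exact: open_closedC.
    apply/seteqP; split=> [x Qx [r r'] [/= rR r'R]|x Qx r r' rR r'R Kx].
      by have [/Qx|] := pselect (K (r^-1 * x * r')); [right; auto|left].
    by have [] := Qx (r, r') (conj rR r'R).
  - move=> n Nn r r' rR r'R Kn.
    have E : r^-1 * n * r' = n ^ r * (r^-1 * 1 * r') by rewrite mulg1 /conjg !mulgA mulgK.
    rewrite E in Kn *; apply: subgroupM => //; first by apply: NB; exact: JN.
    apply: Bgen => //; first exact: mem_head.
    by apply: subgroupMl Kn => //; apply: NK; exact: JN.
  - by move=> x xs r r' rR r'R; apply: Bgen => //; rewrite inE xs orbT.
move=> a Aa.
have Ba : B (1^-1 * a * 1).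
  have : Q a by rewrite QT.
  apply; rewrite ?mem_head // invg1 mul1g mulg1.
  by exists a => //; exists 1; [exact: subgroup1|rewrite mulg1].
move: Ba; rewrite invg1 mul1g mulg1 => -[b [Ab Bb] [n Nn ban]].
have : (A `&` N) n by split=> //; apply: subgroupMl Ab _; rewrite ?ban.
by rewrite AN1 => n1; rewrite -ban n1 mulg1.
Qed.

End Schreier.

(** * Power subgroups and torsion in abelian subgroups *)

Lemma subgroup_chain_stationary (G : groupType) (Z : set G) (E : nat -> set G) :
  (forall k, subgroup (E k)) -> (forall k, E k `<=` E k.+1) ->
  (forall k, E k `<=` Z) -> fin_index Z (E 0%N) ->
  exists K, forall i j, E i `<=` E (K + j)%N.
Proof.
move=> sE E1 EZ [s sP].
have mE i j : (i <= j)%N -> E i `<=` E j.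
  move=> /subnK <-; elim: (j - i)%N => // d IHd; exact: subset_trans IHd (E1 _).
(* Each term is determined by the representatives from [s] that it contains; [K] is a stage by which
   every representative that ever occurs has occurred. *)
have [K KP] : exists K, forall y, y \in s -> forall k, E k y -> E K y.
  elim: s {sP} => [|y s [K KP]]; first by exists 0%N.
  have [[k Ek]|nE] := pselect (exists k, E k y); last first.
    exists K => z; rewrite inE => /orP[/eqP -> k Ey|]; last exact: KP.
    by case: nE; exists k.
  exists (maxn k K) => z; rewrite inE => /orP[/eqP -> _ _|zs i /(KP z zs)].
    by apply: mE Ek; exact: leq_maxl.
  by apply: mE; exact: leq_maxr.
exists K => k j; apply: subset_trans (mE _ _ (leq_addr j K)) => x Ex.
have [y ys E0] := sP x (EZ k x Ex).
have Ey : E k y.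
  have Eyx := mE 0%N k (leq0n k) _ E0.
  by rewrite -[y]invgK; apply: subgroupV => //; exact: subgroupMr Eyx.
rewrite -(mulVKg y x); apply: subgroupM => //; first exact: KP Ey.
exact: mE E0.
Qed.

Section AbelianSubgroups.
Context {G : profiniteGroupType}.
Variables (Z : set G).
Hypotheses (sZ : subgroup Z) (cZ : closed Z).
Hypothesis abZ : forall x y, Z x -> Z y -> commute x y.

Definition powers n : set G := (fun z => z ^+ n) @` Z.

Lemma powers_sub n : powers n `<=` Z.
Proof. by move=> _ [z Zz <-]; exact: subgroupX. Qed.

Lemma powers_subgroup n : subgroup (powers n).
Proof.
split=> [|_ _ [x Zx <-] [y Zy <-]|_ [x Zx <-]].
- by exists 1; [exact: subgroup1|exact: expg1n].
- by exists (x * y); [exact: subgroupM|exact: expgMn (abZ Zx Zy)].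
- by exists x^-1; [exact: subgroupV|exact: expVgn].
Qed.

Lemma powers_closed n : closed (powers n).
Proof.
apply: compact_closed_image; last exact: closed_compact.
by apply: continuousX => x; exact: cvg_id.
Qed.

Lemma expgF n x y : Z x -> Z y -> (x^-1 * y) ^+ n = (x ^+ n)^-1 * y ^+ n.
Proof.
by move=> Zx Zy; rewrite expgMn ?expVgn //; apply: abZ => //; exact: subgroupV.
Qed.

(** Induction on the generators: adjoining [a] to a closed subgroup [B] containing [powers n] adds
    only the cosets of [a ^+ e] with [e < n], since [a ^+ n] is already in [B]. *)
Lemma powers_fin_index (s : seq G) n : (0 < n)%N ->
  topologically_generated s Z -> fin_index Z (powers n).
Proof.
move=> n0 [Zs gZ].
suff [B [sB cB sZB Bs BP]] : exists B, [/\ subgroup B, closed B, powers n `<=` B,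
    (forall x, x \in s -> B x) & fin_index B (powers n)].
  by apply: fin_indexS BP => //; exact: gZ.
elim: s Zs {gZ} => [_|a s IHs Zs].
  exists (powers n); split=> //; [exact: powers_subgroup|exact: powers_closed|].
  by exists [:: 1] => x; exists 1; rewrite ?mem_head // invg1 mul1g.
have Za : Z a by apply: Zs; exact: mem_head.
have [|B [sB cB PB Bs BP]] := IHs; first by move=> x xs; apply: Zs; rewrite inE xs orbT.
(* The bound on [e] makes [C] a finite union of closed sets; [CP] lifts the bound by reduction
   modulo [n]. *)
pose C := [set x | Z x /\ exists2 e, (e < n)%N & B (a ^- e * x)].
have CP x e : Z x -> B (a ^- e * x) -> C x.
  move=> Zx Bx; split=> //; exists (e %% n)%N; first by rewrite ltn_mod.
  have -> : a ^- (e %% n) * x = a ^+ (e %/ n * n) * (a ^- e * x).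
    have -> : a ^+ e = a ^+ (e %% n) * a ^+ (e %/ n * n).
      by rewrite -expgnDr addnC -divn_eq.
    by rewrite invgM -mulgA mulVKg.
  apply: subgroupM => //; apply: PB; exists (a ^+ (e %/ n)); first exact: subgroupX.
  by rewrite -expgnA.
have comm x e : Z x -> commute x (a ^- e).
  by move=> Zx; apply: abZ => //; apply: subgroupV => //; exact: subgroupX.
exists C; split.
- split=> [|x y [Zx [e _ Bx]] [Zy [f _ By]]|x [Zx [e _ Bx]]].
  + by apply: (CP _ 0%N); [exact: subgroup1|rewrite invg1 mul1g; exact: subgroup1].
  + apply: (CP _ (e + f)%N); first exact: subgroupM.
    rewrite addnC expgnDr invgM -mulgA (mulgA _ x) -(comm _ _ Zx) !mulgA -mulgA.
    exact: subgroupM.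
  (* The exponent [e * n.-1] represents [-e] modulo [n]. *)
  + apply: (CP _ (e * n.-1)%N); first exact: subgroupV.
    have -> : a ^- (e * n.-1) * x^-1 = (a ^- e * x)^-1 * a ^- (e * n).
      have -> : a ^- (e * n) = a ^- e * a ^- (e * n.-1).
        by rewrite -{1}(prednK n0) mulnS addnC expgnDr invgM.
      by rewrite invgM invgK !mulgA mulgK comm //; exact: subgroupV.
    apply: subgroupM => //; first exact: subgroupV.
    apply: subgroupV => //; apply: PB; exists (a ^+ e); first exact: subgroupX.
    by rewrite expgnA.
- rewrite (_ : C = Z `&` \bigcup_(e in [set` iota 0 n]) ( *%g (a ^- e) @^-1` B)).
    apply: closedI => //; apply: closed_bigcup; first exact: finite_seq.
    by move=> e _; apply: closed_preimage cB; exact: continuous_lmul.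
  apply/seteqP; split=> x [Zx [e en Be]]; split=> //; exists e => //; move: en;
    by rewrite /= mem_iota.
- move=> x Px; apply: (CP _ 0%N); first exact: powers_sub Px.
  by rewrite invg1 mul1g; exact: PB.
- move=> x; rewrite inE => /orP[/eqP ->|xs].
    apply: (CP _ 1%N) => //; rewrite expg1 mulVg; exact: subgroup1.
  apply: (CP _ 0%N); first by apply: Zs; rewrite inE xs orbT.
  by rewrite invg1 mul1g; exact: Bs.
- apply: fin_index_trans BP; exists [seq a ^+ e | e <- iota 0 n] => x [_ [e en Be]].
  by exists (a ^+ e) => //; apply: map_f; rewrite mem_iota.
Qed.

(* [E k] increases with finite index, hence is stationary from some [K] on;
   thus an [n]-torsion element of [powers (n ^ K)] lies in every
   [powers (n ^ k)]. Modulo an open subgroup the maps [z |-> z ^+ (n ^ i)]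
   cannot be pairwise distinct at [z], which makes such an element trivial. *)
Lemma fin_index_torsion_free (s : seq G) n : (0 < n)%N ->
  topologically_generated s Z ->
  exists Y, [/\ subgroup Y, closed Y, fin_index Z Y &
    forall y, Y y -> y ^+ n = 1 -> y = 1].
Proof.
move=> n0 gZ; have Zn := powers_fin_index n0 gZ.
pose P k := powers (n ^ k)%N.
have sP k : subgroup (P k) by exact: powers_subgroup.
(* [E k] is the product of [powers n] and the [n ^ k]-torsion of [Z]; it is [powers n] itself for
   [k = 0]. *)
pose E k : set G := [set u | Z u /\ P k.+1 (u ^+ (n ^ k)%N)].
have sE k : subgroup (E k).
  split=> [|x y [Zx Px] [Zy Py]|x [Zx Px]].
  - by split; [|rewrite expg1n]; exact: subgroup1.
  - by split; [|rewrite (expgMn _ (abZ Zx Zy))]; exact: subgroupM.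
  - by split; [|rewrite expVgn]; exact: subgroupV.
have [K KP] : exists K, forall i j, E i `<=` E (K + j)%N.
  apply: (@subgroup_chain_stationary _ Z) => //.
  - move=> k u [Zu [w Zw wu]]; split=> //; exists w => //.
    by rewrite expnSr expgnA wu -expgnA -expnSr.
  - by move=> k u [].
  - by apply: fin_indexS Zn => // u Pu; split; [exact: powers_sub Pu|rewrite /P !expn1].
have fiP k : fin_index Z (P k).
  elim: k => [|k IHk].
    exists [:: 1] => x Zx; exists 1; first exact: mem_head.
    by exists (1^-1 * x); [apply: subgroupF => //; exact: subgroup1|].
  have [t tP] := Zn.
  apply: fin_index_trans IHk _; exists [seq y ^+ (n ^ k)%N | y <- t] => _ [z Zz <-].
  have [y yt [w Zw wE]] := tP z Zz; exists (y ^+ (n ^ k)%N); first exact: map_f.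
  have Zy : Z y.
    rewrite -[y]invgK; apply: subgroupV => //; apply: subgroupMr Zz _ => //.
    by rewrite -wE; exact: subgroupX.
  by exists w; rewrite // expnS expgnA wE expgF.
exists (P K); split=> //; first exact: powers_closed.
move=> x Px xn; apply: contrapT => /eqP /open_subgroup_separation[U [sU oU nUx]].
(* If [x] is the [n ^ (K + j)]-th power of [z], then [x ^+ n = 1] puts [z] in [E (K + j).+1], hence
   in [E (K + j)], so [x] lies in the next power subgroup. *)
have Pk j : P (K + j)%N x.
  elim: j => [|j [z Zz zx]]; first by rewrite addn0.
  have [_] : E (K + j)%N z.
    apply: (KP (K + j).+1); split=> //; rewrite expnSr expgnA zx xn; exact: subgroup1.
  by rewrite addnS zx.
have [t tP] := open_fin_index sU oU.
have [z Zz zx] := Pk (size t).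
have /choice[c cP] : forall i, exists y, y \in t /\ U (y^-1 * z ^+ (n ^ i)%N).
  by move=> i; have [y yt Uy] := tP (z ^+ (n ^ i)%N) I; exists y.
have : ~~ uniq [seq c i | i <- iota 0 (size t).+1].
  apply/negP => /uniq_leq_size sizeP.
  have : (size [seq c i | i <- iota 0 (size t).+1] <= size t)%N.
    by apply: sizeP => _ /mapP[i _ ->]; have [] := cP i.
  by rewrite size_map size_iota ltnn.
move=> /(uniqPn 1)[i [j [ij]]]; rewrite size_map size_iota => jt.
rewrite !(nth_map 0%N) ?size_iota // ?(ltn_trans ij) //.
rewrite !nth_iota ?(ltn_trans ij) // !add0n => cij.
set k := (K + size t)%N in zx.
have ik : (i <= k)%N.
  by rewrite (leq_trans (ltnW (leq_trans ij jt))) // leq_addl.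
have : U ((z ^+ (n ^ i)%N)^-1 * z ^+ (n ^ j)%N).
  have [_ Ui] := cP i; have [_ Uj] := cP j.
  by have := subgroupF sU Ui Uj; rewrite cij invgM invgK -mulgA mulVKg.
(* Raising to the power [n ^ (k - i)] turns the two powers of [z] into [x] and [x ^+ (n ^ (j - i))];
   the latter is [1] as [i < j], so [x^-1] lies in [U]. *)
move=> /(subgroupX (n ^ (k - i)) sU).
rewrite expgF; [|exact: subgroupX|exact: subgroupX].
rewrite -!expgnA -!expnD subnKC // zx -(subnKC (ltnW ij)) addnAC subnKC //.
rewrite expnD expgnA zx.
have -> : x ^+ (n ^ (j - i))%N = 1.
  by rewrite -(subnK (_ : 0 < j - i)%N) ?subn_gt0 // addn1 expnS expgnA xn expg1n.
by rewrite mulg1 => /(subgroupV sU); rewrite invgK.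
Qed.

End AbelianSubgroups.

(** * Products of commuting factors and transversals *)

Lemma prodg_perm_commute (G : groupType) (I : eqType) (s t : seq I) (F : I -> G) :
  {in s &, forall i j, commute (F i) (F j)} -> perm_eq s t ->
  \prod_(i <- s) F i = \prod_(i <- t) F i.
Proof.
elim: s t => [|i s IHs] t cF st.
  by move: st; rewrite perm_sym => /perm_nilP ->.
have it : i \in t by rewrite -(perm_mem st) mem_head.
case/splitPr: it st => t1 t2; rewrite perm_sym perm_catC cat_cons perm_cons => st.
have jt1 j : j \in t1 -> j \in s by move=> jt1; rewrite -(perm_mem st) mem_cat jt1 orbT.
rewrite big_cons big_cat big_cons /= (IHs (t1 ++ t2)).
- rewrite big_cat /= !mulgA; congr (_ * _).
  rewrite big_seq; apply: commute_prod => j /jt1 js.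
  by apply: cF; rewrite inE ?eqxx // js orbT.
- by move=> j k js ks; apply: cF; rewrite inE ?js ?ks orbT.
- by rewrite perm_sym perm_catC.
Qed.

(** A representative is kept only when its coset is not yet represented; averaging over cosets needs
    each of them exactly once. *)
Lemma fin_index_transversal (G : groupType) (K : set G) :
  subgroup K -> fin_index setT K ->
  exists R : seq G, [/\ uniq R, forall x, exists2 r, r \in R & K (r^-1 * x)
    & {in R &, forall r r', K (r^-1 * r') -> r = r'}].
Proof.
move=> sK [s sP].
have [R [uR RP Rinj]] : exists R : seq G, [/\ uniq R,
    forall x, x \in s -> exists2 r, r \in R & K (r^-1 * x)
    & {in R &, forall r r', K (r^-1 * r') -> r = r'}].
  elim: s {sP} => [|y s [R [uR RP Rinj]]]; first by exists [::].
  have [[r rR Kry]|nR] := pselect (exists2 r, r \in R & K (r^-1 * y)).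
    by exists R; split=> // x; rewrite inE => /orP[/eqP ->|/RP //]; exists r.
  exists (y :: R); split=> [|x|r r'].
  - rewrite /= uR andbT; apply/negP => yR; apply: nR; exists y => //.
    by rewrite mulVg; exact: subgroup1.
  - rewrite inE => /orP[/eqP ->|/RP[r rR Kr]].
      by exists y; [exact: mem_head|rewrite mulVg; exact: subgroup1].
    by exists r; rewrite // inE rR orbT.
  - rewrite !inE => /orP[/eqP ->|rR] /orP[/eqP ->|r'R] // Kr; last exact: Rinj.
      case: nR; exists r' => //; rewrite -[y in _ * y]invgK -invgM; exact: subgroupV.
    by case: nR; exists r.
exists R; split=> // x; have [y ys Ky] := sP x I; have [r rR Kr] := RP y ys.
by exists r => //; rewrite -(mulVKg y x) mulgA; exact: subgroupM.
Qed.

(** * The retraction, its kernel and the centralizer of [N] *)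

Section Construction.
Context {G : profiniteGroupType}.
Variables (N K : set G) (rho : G -> G).
Hypotheses (nN : normal_subgroup N) (cN : closed N).
Hypotheses (nK : normal_subgroup K) (oK : open K) (NK : N `<=` K).
Hypotheses (rho_cont : continuous rho) (rhoN : forall x, K x -> N (rho x)).
Hypothesis rhoM : forall x y, K x -> K y -> rho (x * y) = rho x * rho y.
Hypothesis rho_id : forall x, N x -> rho x = x.

Let sN : subgroup N := nN.1.
Let sK : subgroup K := nK.1.

Lemma rhoV x : K x -> rho x^-1 = (rho x)^-1.
Proof.
move=> Kx; apply/esym/mulg1_eq; rewrite -rhoM //; last exact: subgroupV.
by rewrite mulgV rho_id //; exact: subgroup1.
Qed.

Lemma rhoJ x y : K x -> K y -> rho (x ^ y) = rho x ^ rho y.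
Proof.
move=> Kx Ky; have Kxy := subgroupM sK Kx Ky; have Kyv := subgroupV sK Ky.
by rewrite /conjg !rhoM ?rhoV.
Qed.

Let L : set G := [set x | K x /\ rho x = 1].

Let sL : subgroup L.
Proof.
split=> [|x y [Kx x1] [Ky y1]|x [Kx x1]].
- by split; [|apply: rho_id]; exact: subgroup1.
- by split; [exact: subgroupM|rewrite rhoM // x1 y1 mulg1].
- by split; [exact: subgroupV|rewrite rhoV // x1 invg1].
Qed.

(** As [n ^ x] stays in [N], it is fixed by [rho], which also sends it to [n ^ rho x = n]. *)
Let L_commN x n : L x -> N n -> commute x n.
Proof.
move=> [Kx x1] Nn; apply/commute_sym.
suff nx : n ^ x = n by rewrite /commute conjgC nx.
rewrite -(rho_id (_ : N (n ^ x))); last exact: nN.2.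
by rewrite rhoJ ?x1 ?conjg1 ?rho_id //; exact: NK.
Qed.

Let L_decomp x : K x -> L (x * (rho x)^-1).
Proof.
move=> Kx; have Kr := NK (rhoN Kx); have Kr' := subgroupV sK Kr.
split; first exact: subgroupM.
by rewrite rhoM // rhoV // (rho_id (rhoN Kx)) mulgV.
Qed.

Let D : set G := [set x | K x /\ forall n, N n -> commute x n].

Let nD : normal_subgroup D.
Proof.
split; first split=> [|x y [Kx cx] [Ky cy]|x [Kx cx]].
- by split; [exact: subgroup1|move=> n _; exact/commute_sym/commute1].
- split; first exact: subgroupM.
  by move=> n Nn; apply/commute_sym/commuteM; apply/commute_sym; auto.
- by split; [exact: subgroupV|move=> n Nn; exact/commute_sym/commuteV/commute_sym/cx].
- move=> x g [Kx cx]; split; first exact: nK.2.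
  move=> n Nn; rewrite -(conjgKV g n) /commute -!conjMg; congr (_ ^ g).
  by apply: cx; exact: nN.2.
Qed.

Let sD : subgroup D := nD.1.

Let LD : L `<=` D.
Proof. by move=> x Lx; split; [exact: Lx.1|move=> n; exact: L_commN]. Qed.

Let cD : closed D.
Proof.
rewrite (_ : D = K `&` \bigcap_(n in N) [set x | x^-1 * (n * x) = n]).
  apply: closedI; first exact: open_subgroup_closed.
  apply: closed_bigI => n _; apply: closed_fiber.
  apply: continuousM; first exact: invg_continuous.
  exact: continuous_lmul.
apply/seteqP; split=> x [Kx cx]; split=> // n Nn.
  by rewrite /= -(cx n Nn) mulKg.
by have /= nx := cx n Nn; rewrite /commute -{1}nx mulVKg.
Qed.

(** Here [k] splits as an element of [L], which commutes with [N], times [rho k]; the latter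
    commutes with [rho x] because [x] centralizes [N] and [rho] is multiplicative. *)
Let rhoD_central x k : D x -> K k -> commute (rho x) k.
Proof.
move=> [Kx cx] Kk; have Nk := rhoN Kk; rewrite -(mulgVK (rho k) k).
apply: commuteM; first by apply/commute_sym/L_commN; [exact: L_decomp|exact: rhoN].
by rewrite /commute -{1 2}(rho_id Nk) -!rhoM ?cx //; exact: NK.
Qed.

Let rhoDJ x k : D x -> K k -> rho (x ^ k) = rho x.
Proof.
move=> Dx Kk; rewrite rhoJ ?Dx.1 //; last exact: Dx.1.
by rewrite /conjg (rhoD_central Dx (NK (rhoN Kk))) mulKg.
Qed.

(** * Averaging [rho] over the cosets of [K] *)

Variable R : seq G.
Hypothesis uR : uniq R.
Hypothesis RP : forall x, exists2 r, r \in R & K (r^-1 * x).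
Hypothesis Rinj : {in R &, forall r r', K (r^-1 * r') -> r = r'}.

(* On [D] the map [rho] has central values and is invariant under conjugation
   by [K], so [F g] depends only on the coset of [g] modulo [K] and the product
   [sigma] of the [F g] is equivariant for conjugation by the whole group. *)
Let F g d := rho (d ^ g^-1) ^ g.
Let sigma d := \prod_(g <- R) F g d.

Let NF g d : D d -> N (F g d).
Proof. by move=> Dd; apply: nN.2; apply: rhoN; exact: nK.2 Dd.1. Qed.

Let F_central g d k : D d -> K k -> commute (F g d) k.
Proof.
move=> Dd Kk; rewrite -(conjgKV g k) /commute -!conjMg; congr (_ ^ g).
by apply: rhoD_central; [exact: nD.2|exact: nK.2].
Qed.

Let F_commute g h d e : D d -> D e -> commute (F g d) (F h e).
Proof. by move=> Dd De; apply: F_central => //; apply: NK; exact: NF. Qed.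

Let F_coset g h d : D d -> K (g^-1 * h) -> F g d = F h d.
Proof.
move=> Dd Kk; rewrite -(mulVKg g h); move: (g^-1 * h) Kk => k Kk.
have -> : F (g * k) d = F g d ^ k.
  rewrite /F -conjgM; congr (_ ^ _).
  have -> : d ^ (g * k)^-1 = (d ^ g^-1) ^ (k^-1 ^ g^-1).
    by rewrite -conjgM (conjgE k^-1) mulVKg invgM.
  rewrite rhoDJ //; first exact: nD.2.
  by apply: nK.2; exact: subgroupV.
by rewrite /conjg (F_central g Dd Kk) mulKg.
Qed.

Let sigmaM : {in D &, forall d e, sigma (d * e) = sigma d * sigma e}.
Proof.
move=> d e; rewrite !inE => Dd De; rewrite /sigma -prodgM_commute.
  apply: eq_bigr => g _; rewrite /F conjMg rhoM ?conjMg //; apply: nK.2.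
    exact: Dd.1.
  exact: De.1.
by move=> *; exact: F_commute.
Qed.

(** Conjugation by [h] permutes the factors, since [F g (d ^ h) = F (g * h^-1) d ^ h]; [tau] is the
    induced permutation of the representatives. *)
Let sigmaJ d h : D d -> sigma (d ^ h) = sigma d ^ h.
Proof.
move=> Dd.
have /choice[tau tauP] : forall g, exists r, r \in R /\ K (r^-1 * (g * h^-1)).
  by move=> g; have [r] := RP (g * h^-1); exists r.
have FJ g : F g (d ^ h) = F (tau g) d ^ h.
  rewrite (F_coset Dd (tauP g).2) /F -!conjgM invgM invgK mulgVK.
  by rewrite conjgM.
rewrite /sigma (eq_bigr _ (fun g _ => FJ g)) -conjg_prod; congr (_ ^ _).
have tauR : perm_eq R (map tau R).
  have utau : uniq (map tau R).
    rewrite map_inj_in_uniq // => g g' gR g'R tE; apply: Rinj => //.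
    have := subgroupF sK (tauP g).2 (tauP g').2; rewrite tE.
    rewrite invgM invgK -mulgA mulVKg invgM invgK => /(nK.2 _ h).
    by rewrite /conjg !mulgA mulVg mul1g -!mulgA mulVg mulg1.
  rewrite perm_sym; apply: uniq_perm => //.
  apply: (uniq_min_size utau _ _).2; last by rewrite size_map.
  by move=> _ /mapP[g _ ->]; exact: (tauP g).1.
rewrite [RHS](prodg_perm_commute _ tauR) ?big_map //.
by move=> *; exact: F_commute.
Qed.

Let sigma_cont : continuous sigma.
Proof.
rewrite /sigma; elim: R => [|g s IHs].
  rewrite (_ : (fun _ => _) = cst 1); first exact: cst_continuous.
  by apply/funext => d; rewrite big_nil.
rewrite (_ : (fun _ => _) = fun d => F g d * \prod_(h <- s) F h d).
  apply: continuousM => //; apply: continuousJ => d.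
  apply: continuous_comp; last exact: rho_cont.
  by apply: continuousJ => x; exact: cvg_id.
by apply/funext => d; rewrite big_cons.
Qed.

(** Conjugates of [z] remain in [N], where [rho] is the identity, so every factor equals [z]. *)
Let sigma_power z : D z -> N z -> sigma z = z ^+ size R.
Proof.
move=> Dz Nz; rewrite /sigma (eq_bigr (fun=> z)).
  by rewrite big_const_seq count_predT iter_mulg_1.
by move=> g _; rewrite /F rho_id ?conjgKV //; exact: nN.2.
Qed.

Let cL : closed L.
Proof.
apply: closedI; first exact: open_subgroup_closed.
exact: closed_fiber rho_cont.
Qed.

(* [D] itself does not do here: the center [D `&` N] of [N] need not be
   topologically finitely generated, whereas [D0 `&` N] is. *)
Let D0 : set G := smallest [set A | closed A /\ normal_subgroup A] L.

Let LD0 : L `<=` D0. Proof. exact: sub_smallest. Qed.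

Let D0_sub A : closed A -> normal_subgroup A -> L `<=` A -> D0 `<=` A.
Proof. by move=> cA nA; exact: smallest_sub. Qed.

Let cD0 : closed D0.
Proof. by apply: closed_bigI => A [[]]. Qed.

Let nD0 : normal_subgroup D0.
Proof.
split; first split=> [A [[_ nA] _]|x y D0x D0y A LA|x D0x A LA].
- exact: normal_subgroup1.
- by apply: normal_subgroupM LA.1.2 _ _; [exact: D0x|exact: D0y].
- by apply: normal_subgroupV LA.1.2 _; exact: D0x.
- by move=> x g D0x A LA; apply: normal_subgroupJ LA.1.2 _; exact: D0x.
Qed.

Let sD0 : subgroup D0 := nD0.1.

Let D0D : D0 `<=` D. Proof. exact: D0_sub. Qed.

Let Z0 := D0 `&` N.

Let sZ0 : subgroup Z0.
Proof. exact: subgroupI. Qed.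

Let cZ0 : closed Z0. Proof. exact: closedI. Qed.

Let abZ0 x y : Z0 x -> Z0 y -> commute x y.
Proof. by move=> [/D0D[_ cx] _] [_ Ny]; exact: cx. Qed.

Let JZ0 x g : Z0 x -> Z0 (x ^ g).
Proof. by move=> [Dx Nx]; split; [exact: nD0.2|exact: nN.2]. Qed.

(** [rho x] equals [(x * (rho x)^-1)^-1 * x], and [x * (rho x)^-1] lies in [L], hence in [D0]. *)
Let rhoD0 x : D0 x -> Z0 (rho x).
Proof.
move=> D0x; have Kx := (D0D D0x).1; split; last exact: rhoN.
have := subgroupF sD0 (LD0 (L_decomp Kx)) D0x.
by rewrite invgM invgK mulgVK.
Qed.

Let FD0 g x : D0 x -> Z0 (F g x).
Proof. by move=> D0x; apply: JZ0; apply: rhoD0; exact: nD0.2. Qed.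

Let sigmaD0 x : D0 x -> Z0 (sigma x).
Proof.
move=> D0x; rewrite /sigma; apply: big_ind => [|y z|g _].
- exact: subgroup1.
- exact: subgroupM.
- exact: FD0.
Qed.

(** * Finite generation of [Z0] and the virtual complement *)

Variable s : seq G.
Hypothesis gen : forall Q, subgroup Q -> closed Q -> N `<=` Q ->
  (forall x, x \in s -> Q x) -> Q = setT.

Let LN : [set x * y | x in L & y in N] = K.
Proof.
apply/seteqP; split=> [_ [x [Kx _] [y Ny <-]]|x Kx].
  by apply: subgroupM => //; exact: NK.
exists (x * (rho x)^-1); first exact: L_decomp.
by exists (rho x); [exact: rhoN|rewrite mulgVK].
Qed.

(** [L] is finitely generated as a complement of [N] in [K]. A closed subgroup [B] containing the
    listed images determines a closed normal subgroup [Q] that contains [L], hence [D0]; and [rho]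
    is the identity on [Z0]. *)
Let Z0_generated : exists t, topologically_generated t Z0.
Proof.
have [||t [tL gL]] := complement_topologically_generated nN cN gen sL cL.
- apply/seteqP; split=> [x [[_ x1] Nx]|_ ->] /=; first by rewrite -(rho_id Nx).
  by split; exact: subgroup1.
- by rewrite LN.
exists [seq rho (x ^ r) | x <- t, r <- R].
split=> [_ /allpairsP[[x r] [/= xt rR ->]]|B sB cB Bt].
  by apply: rhoD0; apply: nD0.2; apply: LD0; exact: tL.
pose Q : set G := [set x | D x /\ forall g, B (rho (x ^ g))].
have KD x g : D x -> K (x ^ g) by move=> Dx; apply: nK.2; exact: Dx.1.
have sQ g : subgroup [set x | D x /\ B (rho (x ^ g))].
  split=> [|x y [Dx Bx] [Dy By]|x [Dx Bx]].
  - split; first exact: subgroup1.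
    by rewrite conj1g rho_id; exact: subgroup1.
  - split; first exact: subgroupM.
    by rewrite conjMg rhoM; [exact: subgroupM|exact: KD|exact: KD].
  - split; first exact: subgroupV.
    by rewrite conjVg rhoV; [exact: subgroupV|exact: KD].
have cQ g : closed [set x | D x /\ B (rho (x ^ g))].
  apply: closedI => //; apply: (closed_preimage (f := fun x => rho (x ^ g))) => //.
  move=> x; apply: continuous_comp; last exact: rho_cont.
  by apply: continuousJ => y; exact: cvg_id.
have nQ : normal_subgroup Q.
  split; first split=> [|x y [Dx Bx] [Dy By]|x [Dx Bx]].
  - by split=> [|g]; [exact: subgroup1|have [_] := subgroup1 (sQ g)].
  - split=> [|g]; first exact: subgroupM.
    by have [] := @subgroupM _ _ x y (sQ g) (conj Dx (Bx g)) (conj Dy (By g)).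
  - split=> [|g]; first exact: subgroupV.
    by have [] := @subgroupV _ _ x (sQ g) (conj Dx (Bx g)).
  - by move=> x h [Dx Bx]; split=> [|g]; [exact: nD.2|rewrite -conjgM].
have cQ' : closed Q.
  rewrite (_ : Q = \bigcap_(g in setT) [set x | D x /\ B (rho (x ^ g))]).
    by apply: closed_bigI => g _; exact: cQ.
  apply/seteqP; split=> x; first by move=> [Dx Bx] g _; split.
  by move=> Qx; split=> [|g]; [have [] := Qx 1 I|have [] := Qx g I].
(* Only the coset of [g] modulo [K] affects [rho (l ^ g)], so the representatives in [R] suffice. *)
have LQ : L `<=` Q.
  move=> l Ll; split=> [|g]; first exact: LD.
  have [r rR Kr] := RP g.
  have -> : rho (l ^ g) = rho (l ^ r).
    by rewrite -(mulVKg r g) conjgM; apply: rhoDJ Kr; apply: nD.2; exact: LD.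
  suff /(_ l Ll)[] : L `<=` [set x | D x /\ B (rho (x ^ r))] by [].
  apply: gL => // x xt; split; first exact/LD/tL.
  apply: Bt; exact: allpairs_f.
move=> z [D0z Nz]; have [_ /(_ 1)] := D0_sub cQ' nQ LQ D0z.
by rewrite conjg1 rho_id.
Qed.

Let R_gt0 : (0 < size R)%N.
Proof. by have [r] := RP 1; case: R. Qed.

Lemma virtual_complement :
  exists M, [/\ normal_subgroup M, closed M, M `<=` K, M `&` N = [set 1]
    & open [set x * y | x in M & y in N]].
Proof.
have [t gZ0] := Z0_generated.
have [Y [sY cY ZY Ytf]] := fin_index_torsion_free sZ0 cZ0 abZ0 R_gt0 gZ0.
have sigmaMD x y : D0 x -> D0 y -> sigma (x * y) = sigma x * sigma y.
  by move=> D0x D0y; apply: sigmaM; rewrite inE; exact: D0D.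
have sigmaX z : Z0 z -> sigma z = z ^+ size R.
  by move=> [D0z Nz]; apply: sigma_power => //; exact: D0D.
have sigma1 : sigma 1 = 1 by rewrite (sigmaX _ (subgroup1 sZ0)) expg1n.
have sigmaV x : D0 x -> sigma x^-1 = (sigma x)^-1.
  move=> D0x; have D0x' := subgroupV sD0 D0x; apply/esym/mulg1_eq.
  by rewrite -sigmaMD // mulgV.
pose M0 : set G := [set x | D0 x /\ sigma x = 1].
have nM0 : normal_subgroup M0.
  split; first split=> [|x y [D0x x1] [D0y y1]|x [D0x x1]].
  - by split; first exact: subgroup1 sD0.
  - by split; [exact: subgroupM sD0 _ _|rewrite sigmaMD // x1 y1 mulg1].
  - by split; [exact: subgroupV sD0 _|rewrite sigmaV // x1 invg1].
  - move=> x g [D0x x1]; split; first exact: nD0.2.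
    by rewrite sigmaJ ?x1 ?conj1g //; exact: D0D.
have sM0 := nM0.1.
have M0K x : M0 x -> K x by move=> [/D0D[]].
have rhoF x y : M0 x -> M0 y -> rho (x^-1 * y) = (rho x)^-1 * rho y.
  by move=> /M0K Kx /M0K Ky; rewrite rhoM ?rhoV //; exact: subgroupV.
pose B : set G := M0 `&` rho @^-1` Y.
have sB : subgroup B.
  split=> [|x y [Mx Yx] [My Yy]|x [Mx Yx]].
  - by split; [|rewrite /= rho_id]; exact: subgroup1.
  - split; first exact: subgroupM.
    by rewrite /= rhoM; [exact: subgroupM|exact: M0K|exact: M0K].
  - split; first exact: subgroupV.
    by rewrite /= rhoV; [exact: subgroupV|exact: M0K].
have cB : closed B.
  apply: closedI; last exact: closed_preimage.
  by apply: closedI => //; exact: closed_fiber.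
have nM := core_normal sB.
have MM0 : core B `<=` M0 by move=> x /core_sub[].
(* On such a [z] the map [sigma] is the power map and [rho] the identity, so [z] is an element of
   [Y] with [z ^+ size R = 1]. *)
have MN1 : core B `&` N = [set 1].
  apply/seteqP; split=> [z [/core_sub[[D0z z1] Yz] Nz]|_ ->]; last first.
    by split; [exact: normal_subgroup1 nM|exact: subgroup1].
  by apply: Ytf; [rewrite -(rho_id Nz)|rewrite -sigmaX].
have cM := closed_core cB.
have M0M : fin_index M0 (core B).
  apply: (@fin_index_core _ M0 B K) => //.
  - by move=> x [].
  - move=> x k Kk [M0x Yx]; split; first exact: nM0.2.
    by rewrite /= rhoDJ //; exact: D0D M0x.1.
  - exact: open_fin_index.
  - apply: fin_index_preimage ZY => //.
    by move=> _ [x [D0x _] <-]; exact: rhoD0.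
have D0M0 : fin_index D0 (D0 `&` sigma @^-1` powers Z0 (size R)).
  apply: (@fin_index_preimage _ D0 Z0) => //.
  - by move=> x y D0x D0y; rewrite sigmaMD ?sigmaV //; exact: subgroupV sD0 _.
  - exact: powers_subgroup.
  - by move=> _ [x D0x <-]; exact: sigmaD0.
  - exact: powers_fin_index gZ0.
exists (core B); split=> //; first by move=> x /MM0/M0K.
apply: closed_fin_index_open; first exact: closed_mulset.
  exact: mulset_subgroup nM.1 nN.
apply: fin_index_trans (open_fin_index sK oK) _.
have [u uP] := D0M0; have [v vP] := M0M.
exists [seq y * y' | y <- u, y' <- v] => x Kx.
have [y yu [D0d [z Z0z /= zn]]] := uP _ (LD0 (L_decomp Kx)).
set d := y^-1 * _ in D0d zn.
(* The factor [z^-1] corrects [d] into the kernel of [sigma], and [x = y * (d * z^-1) * (z * rho x)]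
   with last factor in [N]. *)
have M0m : M0 (d * z^-1).
  have D0z := subgroupV sD0 Z0z.1; split; first exact: subgroupM sD0 D0d D0z.
  by rewrite sigmaMD // (sigmaV _ Z0z.1) (sigmaX _ Z0z) [_ ^+ _]zn mulgV.
have [y' y'v Mm] := vP _ M0m.
exists (y * y'); first exact: allpairs_f.
exists (y'^-1 * (d * z^-1)) => //; exists (z * rho x).
  by apply: subgroupM => //; [exact: Z0z.2|exact: rhoN].
by rewrite /d invgM !mulgA mulgVK mulgVK.
Qed.

End Construction.

(** * Reduction to an open normal subgroup inside [H] *)

Theorem theorem3 (G : profiniteGroupType) (N : set G)
    (nN : normal_subgroup N) (cN : closed N) (rN : virtual_retract N)
    (fgGN : topologically_fg_group (quotg nN))
    (H : set G) (sH : subgroup H) (oH : open H) (NH : N `<=` H) :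
  exists M : set G,
    [/\ normal_subgroup M, closed M & topologically_fg M] /\
    [/\ M `<=` H, M `&` N = [set 1]
      & open [set x * y | x in M & y in N]].
Proof.
have [s gen] := quotg_topologically_generated fgGN.
have [K0 [rho0 [sK0 oK0 NK0 [rho0_cont rho0M rho0K] rho0_id]]] := rN.
have sKH := subgroupI sK0 sH; have oKH := openI oK0 oH.
pose K := core (K0 `&` H).
have nK : normal_subgroup K by exact: core_normal.
have KKH : K `<=` K0 `&` H by exact: core_sub.
have NK : N `<=` K by move=> x Nx g; split; [apply: NK0|apply: NH]; exact: nN.2.
have cKH : closed (K0 `&` H) by exact: open_subgroup_closed.
have oK : open K.
  apply: closed_fin_index_open nK.1 _.
    exact: closed_core.
  apply: (@fin_index_core _ setT _ (K0 `&` H)) => //.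
  - by move=> x k Kk Kx; exact: subgroupJ.
  - exact: open_fin_index.
  - exact: open_fin_index.
(* The value [1] off the clopen subgroup [K] makes [rho] continuous on all of [G], so that the
   construction involves no subspace topology. *)
pose rho x := if x \in K then rho0 x else 1.
have rhoE x : K x -> rho x = rho0 x by move=> Kx; rewrite /rho mem_set.
have rho_cont : continuous rho.
  move=> x W; have [Kx|nKx] := pselect (K x).
    rewrite (rhoE x Kx) => nW.
    have cx : {for x, continuous rho0}.
      move: rho0_cont; rewrite continuous_open_subspace // => /(_ x); apply.
      by apply: mem_set; have [] := KKH x Kx.
    apply: filterS2 (open_nbhs_nbhs (conj oK Kx)) (cx W nW) => y Ky.
    by rewrite /= rhoE.
  rewrite {1}/rho memNset // => /nbhs_singleton W1.
  have onK : open (~` K).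
    by apply: closed_openC; exact: open_subgroup_closed nK.1 oK.
  apply: filterS (open_nbhs_nbhs (conj onK nKx)) => y nKy.
  by rewrite /= /rho memNset.
have rhoN x : K x -> N (rho x).
  by move=> Kx; rewrite rhoE // -rho0K; exists x => //; have [] := KKH x Kx.
have rhoM x y : K x -> K y -> rho (x * y) = rho x * rho y.
  move=> Kx Ky; rewrite !rhoE //; last exact: subgroupM nK.1 Kx Ky.
  by apply: rho0M; [have [] := KKH x Kx|have [] := KKH y Ky].
have rho_id x : N x -> rho x = x.
  by move=> Nx; rewrite rhoE ?rho0_id //; exact: NK.
have [R [uR RP Rinj]] := fin_index_transversal nK.1 (open_fin_index nK.1 oK).
have [M [nM cM MK MN1 oMN]] := virtual_complement nN cN nK oK NK rho_cont
  rhoN rhoM rho_id uR RP Rinj gen.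
exists M; split; split=> //; last by move=> x /MK/KKH[].
(* As a complement of [N] in an open subgroup, [M] inherits finite generation from the quotient by
   [N]. *)
have [t gt] := complement_topologically_generated nN cN gen nM.1 cM MN1 oMN.
exact: topologically_generated_fg nM.1 cM gt.
Qed.
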